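(* For every constant $\epsilon_0>0$ there exist constants $c>0$ and $N\in\mathbb{N}$ such that for every $0<\epsilon\le \epsilon_0$ and every integer $n\ge N$, there exists a metric space $\mathcal{M}=(V,d)$ with $|V|=n$ such that every $\epsilon$-differentially private algorithm for the super-set output facility location problem on $\mathcal{M}$ has expected approximation ratio at least $$c\cdot \min\left\{\frac{\log n}{\log\log n},\ \sqrt{\frac{\log n}{\epsilon}}\right\}.$$ In other words, if $\alpha$ is such that an $\epsilon$-DP algorithm $A$ satisfies $\mathbb{E}_{\psi\sim A(\mathbf{X};\mathcal{M},\mathbf{f})}[\mathrm{cost}_{\mathcal{M},\mathbf{f},\mathbf{X}}(\psi)]\le \alpha\cdot \mathrm{opt}_{\mathcal{M},\mathbf{f},\mathbf{X}}$ for all facility costs $\mathbf{f}$ and all client datasets $\mathbf{X}$, then $\alpha\ge c\cdot\min\{\log n/\log\log n,\sqrt{\log n/\epsilon}\}$.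
   Context: Super-set output facility location (SOFL): given a finite metric space $\mathcal{M}=(V,d)$, facility costs $\mathbf{f}=(f_v)_{v\in V}$ with $f_v\ge 0$, and a dataset of clients $\mathbf{X}=(x_1,\dots,x_m)\in V^m$, an algorithm outputs a map $\psi:V\to V$. The set of open facilities is $S_{\psi,\mathbf{X}}=\psi(\{x_1,\dots,x_m\})$ and the cost is $\mathrm{cost}_{\mathcal{M},\mathbf{f},\mathbf{X}}(\psi)=\sum_{s\in S_{\psi,\mathbf{X}}} f_s+\sum_{i=1}^m d(x_i,\psi(x_i))$. For a set $S\subseteq V$, $\mathrm{cost}_{\mathcal{M},\mathbf{f},\mathbf{X}}(S)=\sum_{s\in S}f_s+\sum_{i=1}^m\min_{u\in S}d(x_i,u)$, and $\mathrm{opt}_{\mathcal{M},\mathbf{f},\mathbf{X}}=\min_{S\subseteq V}\mathrm{cost}_{\mathcal{M},\mathbf{f},\mathbf{X}}(S)$. A randomized algorithm $A$ (with $\mathcal{M},\mathbf{f}$ fixed, taking $\mathbf{X}$ as its private input) has expected approximation ratio $\alpha$ if $\mathbb{E}_{\psi\sim A(\mathbf{X};\mathcal{M},\mathbf{f})}[\mathrm{cost}_{\mathcal{M},\mathbf{f},\mathbf{X}}(\psi)]\le\alpha\cdot\mathrm{opt}_{\mathcal{M},\mathbf{f},\mathbf{X}}$ for all $\mathbf{f},\mathbf{X}$. Two datasets $\mathbf{X},\mathbf{X}'\in V^m$ are adjacent if they differ in at most one coordinate. $A$ is $\epsilon$-differentially private ($\epsilon$-DP) if for all adjacent $\mathbf{X},\mathbf{X}'$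 and every output $\psi$, $\Pr[A(\mathbf{X})=\psi]\le e^{\epsilon}\Pr[A(\mathbf{X}')=\psi]$. *)

(* Defs.v *)
From mathcomp Require Import all_boot all_order all_algebra.
From mathcomp Require Import all_classical all_reals.
From mathcomp Require Import all_analysis.
Set Implicit Arguments. Unset Strict Implicit. Unset Printing Implicit Defensive.
Import Order.TTheory GRing.Theory Num.Theory.
Local Open Scope ring_scope.

Section SOFL.
Variables (R : realType) (V : finType).

Definition is_metric (d : V -> V -> R) : Prop :=
  (forall x y, 0 <= d x y) /\ (forall x y, d x y = 0 <-> x = y) /\
  (forall x y, d x y = d y x) /\ (forall x y z, d x z <= d x y + d y z).

Definition nonneg_costs (f : V -> R) : Prop := forall v, 0 <= f v.

Definition cost_map (d : V -> V -> R) (f : V -> R) (m : nat) (X : m.-tuple V)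
    (psi : {ffun V -> V}) : R :=
  \sum_(s in [set psi (tnth X i) | i : 'I_m]) f s
  + \sum_(i < m) d (tnth X i) (psi (tnth X i)).

(* min_{u in S} d(x,u)  (meaningful for nonempty S) *)
Definition dist_set (d : V -> V -> R) (S : {set V}) (x : V) : R :=
  d x (Order.arg_min x (fun u => u \in S) (fun u => d x u)).

Definition cost_set (d : V -> V -> R) (f : V -> R) (m : nat) (X : m.-tuple V)
    (S : {set V}) : R :=
  \sum_(s in S) f s + \sum_(i < m) dist_set d S (tnth X i).

(* opt = min over nonempty S of cost_set (the empty set has infinite cost
   as soon as m >= 1) *)
Definition opt (d : V -> V -> R) (f : V -> R) (m : nat) (X : m.-tuple V) : R :=
  cost_set d f X (Order.arg_min (finset.setTfor V) (fun S : {set V} => (0 < #|S|)%N) (fun S => cost_set d f X S)).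

(* A randomized algorithm: given the (public) facility costs f and the
   private dataset X of any size m, a probability distribution over maps
   psi : V -> V. *)
Definition algorithm := forall (f : V -> R) (m : nat), m.-tuple V -> {ffun {ffun V -> V} -> R}.

Definition is_distribution (P : {ffun {ffun V -> V} -> R}) : Prop :=
  (forall psi, 0 <= P psi) /\ \sum_psi P psi = 1.

Definition valid_algorithm (A : algorithm) : Prop :=
  forall f m (X : m.-tuple V), is_distribution (A f m X).

Definition adjacent (m : nat) (X X' : m.-tuple V) : bool :=
  (#|[set i : 'I_m | tnth X i != tnth X' i]| <= 1)%N.

Definition is_DP (eps : R) (A : algorithm) : Prop :=
  forall f m (X X' : m.-tuple V), adjacent X X' ->
    forall psi, A f m X psi <= expR eps * A f m X' psi.

Definition expected_cost (d : V -> V -> R) (A : algorithm) (f : V -> R) (m : nat)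
    (X : m.-tuple V) : R :=
  \sum_psi A f m X psi * cost_map d f X psi.

Definition has_approx_ratio (d : V -> V -> R) (A : algorithm) (alpha : R) : Prop :=
  forall f, nonneg_costs f -> forall m (X : m.-tuple V),
    expected_cost d A f X <= alpha * opt d f X.

End SOFL.

(* Main.v *)
Require Import Defs.
From mathcomp Require Import all_boot all_order all_algebra.
From mathcomp Require Import all_classical all_reals.
From mathcomp Require Import all_analysis.
From mathcomp Require Import zify ring lra.
Import Order.TTheory GRing.Theory Num.Theory.
Local Open Scope ring_scope.

(** The metric is the truncated shortest-path metric of a graph of girth more
    than 2M+3 in which almost all vertices have degree k = JM; a maximal graph
    of girth > g and degree at most k has this property, because its vertices
    of degree < k lie pairwise within distance g.  All facilities cost M, and a
    dataset X(c,j) consists of M of the k neighbours of a vertex c (the j-th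
    chunk), so that opening c alone costs at most 2M.  Suppose that a fixed map
    psi has cost at most M^2/4 on X(c,j).  Then few facilities are open and few
    clients travel further than M.  Up to this distance the graph looks like a
    tree, so two clients can only share a facility if psi sends one of them
    towards c, and hence at least M/2 clients are sent towards c.  A vertex is
    sent towards at most one neighbour, so psi is that good on at most a
    fraction O(1/k) of the pairs (c,j).  Datasets of size M are M changes
    apart, so by group privacy an algorithm of ratio below M/16 yields
    exp(-eps M)/2 <= O(1/k).  This fails when k is a large multiple of
    M exp(eps M), and n = k^O(M) vertices suffice for such a graph, which allows
    M to be of order min(log n / log log n, sqrt(log n / eps)). *)

(** * Bounded-length walks, girth and the truncated graph distance *)

Section Reach.
Set Implicit Arguments. Unset Strict Implicit. Unset Printing Implicit Defensive.
Variable T : finType.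
Implicit Types (E : {set T * T}) (x y z u v s : T) (g H i j k : nat).
Local Open Scope nat_scope.
Import fintype mathcomp.boot.finset.

Fixpoint reach E j x y : bool :=
  if j is j'.+1 then reach E j' x y || [exists z, reach E j' x z && ((z, y) \in E)]
  else x == y.

Definition symmetric_edges E := [forall x, forall y, ((x, y) \in E) == ((y, x) \in E)].

Lemma symmetric_edgesP E : symmetric_edges E -> forall x y, ((x, y) \in E) = ((y, x) \in E).
Proof. by move=> /forallP h x y; move/(_ x)/forallP/(_ y)/eqP: h. Qed.

Definition edge u v : {set T * T} := [set (u, v); (v, u)].

Lemma reach_refl E j x : reach E j x x.
Proof. by elim: j => //= j ->. Qed.

Lemma reach_leq E i j x y : i <= j -> reach E i x y -> reach E j x y.
Proof.
move=> /subnK <-; elim: (j - i) => [//|m IH] h.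
by rewrite addSn /= IH.
Qed.

Lemma reach_step E j x y z : reach E j x y -> (y, z) \in E -> reach E j.+1 x z.
Proof. by move=> h1 h2 /=; apply/orP; right; apply/existsP; exists y; rewrite h1. Qed.

Lemma reach_edge E x y : (x, y) \in E -> reach E 1 x y.
Proof. by apply: reach_step; exact: reach_refl. Qed.

Lemma reach_subset E E' j x y : E \subset E' -> reach E j x y -> reach E' j x y.
Proof.
move=> /subsetP sEE; elim: j y => //= j IH y /orP[/IH->//|/existsP[z /andP[/IH h /sEE e]]].
by apply/orP; right; apply/existsP; exists z; rewrite h.
Qed.

Lemma reach_trans E i j x y z : reach E i x y -> reach E j y z -> reach E (i + j) x z.
Proof.
move=> hxy; elim: j z => [|j IH] z /=; first by move=> /eqP <-; rewrite addn0.
rewrite addnS => /orP[/IH h|/existsP[w /andP[/IH h e]]].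
  exact: reach_leq h.
exact: reach_step h e.
Qed.

Lemma reach_sym E j x y : symmetric_edges E -> reach E j x y -> reach E j y x.
Proof.
move=> sE; elim: j x y => [x y /eqP -> /=|j IH x y /= /orP[/IH ->//|]]; first exact: eqxx.
move=> /existsP[z /andP[/IH h e]].
apply: (@reach_trans _ 1 j y z x) => //; apply: reach_edge.
by rewrite symmetric_edgesP.
Qed.

(** A second crossing of the new edge can be cut out: crossing it again in the same direction drops
    the part in between, and crossing it back leaves a walk in [E]. *)
Lemma reach_add_edge E u v j x y : reach (E :|: edge u v) j x y ->
  reach E j x y \/
  exists a b, a + b < j /\
    (reach E a x u /\ reach E b v y \/ reach E a x v /\ reach E b u y).
Proof.
elim: j y => [y|j IH y]; first by left.
move=> /= /orP[/IH[->|[a [b [ab h]]]]|]; first by left.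
  by right; exists a, b; split=> //; exact: ltnW.
move=> /existsP[z /andP[/IH hz]]; rewrite !inE => /orP[zy|uvzy].
  case: hz => [hz|[a [b [ab h]]]].
    by left; exact: reach_step hz zy.
  right; exists a, b.+1; split; first by lia.
  by case: h => -[h1 h2]; [left|right]; split=> //; apply: reach_step zy.
have [] : (z = u /\ y = v) \/ (z = v /\ y = u).
  by case/orP: uvzy => /eqP[-> ->]; [left|right].
- move=> [zu yv]; subst z y.
  case: hz => [hz|[a [b [ab [[h1 h2]|[h1 h2]]]]]].
  + by right; exists j, 0; split; [lia|left; rewrite reach_refl].
  + by right; exists a, 0; split; [lia|left; rewrite reach_refl].
  + left; apply: (@reach_leq E a j.+1) h1; lia.
- move=> [zu yv]; subst z y.
  case: hz => [hz|[a [b [ab [[h1 h2]|[h1 h2]]]]]].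
  + by right; exists j, 0; split; [lia|right; rewrite reach_refl].
  + left; apply: (@reach_leq E a j.+1) h1; lia.
  + by right; exists a, 0; split; [lia|right; rewrite reach_refl].
Qed.

(** An edge and a detour around it form a cycle, so for symmetric [E] every cycle is longer than
    [g + 1]. Loops are excluded too, since [reach] is reflexive. *)
Definition girth_gt g E := [forall a, forall b, ((a, b) \in E) ==> ~~ reach (E :\: edge a b) g a b].

Lemma girth_gtP g E : reflect (forall a b, (a, b) \in E -> ~~ reach (E :\: edge a b) g a b)
  (girth_gt g E).
Proof.
apply: (iffP forallP) => [h a b|h a].
  by move/forallP: (h a) => /(_ b)/implyP.
by apply/forallP => b; apply/implyP; exact: h.
Qed.

Lemma edgeC u v : edge u v = edge v u.
Proof. by rewrite /edge setUC. Qed.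

Lemma symmetric_setU E u v : symmetric_edges E -> symmetric_edges (E :|: edge u v).
Proof.
move=> /symmetric_edgesP sE; apply/forallP => x; apply/forallP => y; apply/eqP.
rewrite !inE (sE x y) !xpair_eqE ; congr (_ || _).
by rewrite orbC andbC [(x == u) && _]andbC.
Qed.

Lemma symmetric_setD E u v : symmetric_edges E -> symmetric_edges (E :\: edge u v).
Proof.
move=> /symmetric_edgesP sE; apply/forallP => x; apply/forallP => y; apply/eqP.
rewrite !inE (sE x y) !xpair_eqE ; congr (~~ _ && _).
by rewrite orbC andbC [(x == u) && _]andbC.
Qed.

(** Deleting the new edge restores [E], where [u] and [v] are far apart. A short detour around an
    old edge [(a, b)] would have to use the new edge; its two remaining pieces, joined by [(a, b)],
    would connect [u] to [v] within [g] in [E]. *)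
Lemma girth_add_edge g E u v : 0 < g -> symmetric_edges E -> girth_gt g E ->
  ~~ reach E g u v -> girth_gt g (E :|: edge u v).
Proof.
move=> g0 sE /girth_gtP gE nuv; apply/girth_gtP => a b.
have uvE : (u, v) \notin E.
  by apply: contra nuv => /reach_edge; exact: reach_leq.
have vuE : (v, u) \notin E by rewrite (symmetric_edgesP sE).
have delE : (E :|: edge u v) :\: edge u v = E.
  apply/setP => -[p q]; rewrite in_setD in_setU.
  case: (boolP ((p, q) \in edge u v)) => /= h; last by rewrite orbF.
  by move: h; rewrite !inE => /orP[]/eqP[-> ->]; rewrite ?(negPf uvE) ?(negPf vuE).
rewrite in_setU => /orP[abE|]; last first.
  rewrite !inE => /orP[]/eqP[-> ->]; first by rewrite delE.
  by rewrite [edge v u]edgeC delE; apply: contra nuv; exact: reach_sym.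
have sub : (E :|: edge u v) :\: edge a b \subset (E :\: edge a b) :|: edge u v.
  by apply/subsetP => p; rewrite !inE => /andP[-> /=].
apply/negP => /(reach_subset sub) /reach_add_edge[|].
  by apply/negP; exact: gE.
have baE : (b, a) \in E by rewrite (symmetric_edgesP sE).
have DE : E :\: edge a b \subset E by exact: subsetDl.
move=> [i [j [ij h]]]; move: nuv => /negP; apply.
case: h => -[/(reach_subset DE)h1 /(reach_subset DE)h2].
  apply: (@reach_leq E (i + 1 + j)); first lia.
  apply: reach_trans (reach_sym sE h2); apply: reach_trans (reach_edge abE).
  exact: reach_sym.
apply: (@reach_leq E (j + 1 + i)); first lia.
apply: reach_trans (h1); apply: reach_trans (reach_edge baE).
exact: h2.
Qed.

Lemma girth_irrefl g E x y : girth_gt g E -> (x, y) \in E -> x != y.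
Proof.
move=> /girth_gtP gE xy; apply/negP => /eqP exy.
by move: (gE _ _ xy); rewrite exy reach_refl.
Qed.

(** A walk of length at most [j] that met [x] before its end would reach [x] in fewer than [j]
    steps. *)
Lemma reach_avoid E j s x z : (forall i, i < j -> ~~ reach E i s x) -> z != x ->
  reach E j s z -> reach [set e in E | (e.1 != x) && (e.2 != x)] j s z.
Proof.
elim: j z => [//|j IH] z hx zx /=.
have hx' i : i < j -> ~~ reach E i s x by move=> ij; apply: hx; exact: ltnW.
move=> /orP[/IH->//|/existsP[w /andP[sw wz]]].
have wx : w != x by apply: contra (hx j (ltnSn j)) => /eqP <-.
by apply/orP; right; apply/existsP; exists w; rewrite IH // inE wz wx zx.
Qed.

Lemma graph_dist_subproof E H x y : exists j, (H <= j) || reach E j x y.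
Proof. by exists H; rewrite leqnn. Qed.

(** The minimum of [H] and the path distance; truncation keeps it finite on disconnected graphs. *)
Definition graph_dist E H x y : nat := ex_minn (graph_dist_subproof E H x y).

Lemma graph_dist_leq E H x y j : (graph_dist E H x y <= j) = (H <= j) || reach E j x y.
Proof.
rewrite /graph_dist; case: ex_minnP => m hm min; apply/idP/idP => [mj|/min//].
case/orP: hm => [Hm|h]; first by rewrite (leq_trans Hm mj).
by rewrite (reach_leq mj h) orbT.
Qed.

Lemma graph_dist_reach E H x y : graph_dist E H x y < H ->
  reach E (graph_dist E H x y) x y.
Proof.
by have := leqnn (graph_dist E H x y); rewrite graph_dist_leq => /orP[h|//]; rewrite ltnNge h.
Qed.

Lemma graph_dist_eq0 E H x y : 0 < H -> (graph_dist E H x y == 0) = (x == y).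
Proof. by move=> H0; rewrite -leqn0 graph_dist_leq leqNgt H0. Qed.

Lemma graph_dist_sym E H x y : symmetric_edges E -> graph_dist E H x y = graph_dist E H y x.
Proof.
move=> sE; apply/eqP; rewrite eqn_leq !graph_dist_leq.
have aux a b : (H <= graph_dist E H a b) || reach E (graph_dist E H a b) b a.
  by case: leqP => //= /graph_dist_reach /reach_sym; apply.
by rewrite !aux.
Qed.

Lemma graph_dist_triangle E H x y z :
  graph_dist E H x z <= graph_dist E H x y + graph_dist E H y z.
Proof.
rewrite graph_dist_leq; case: leqP => //= h; apply: reach_trans; apply: graph_dist_reach; lia.
Qed.

Lemma graph_dist_edge E H x y : (x, y) \in E -> graph_dist E H x y <= 1.
Proof. by move=> xy; rewrite graph_dist_leq reach_edge ?orbT. Qed.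

(* Balls of radius less than [H] around [s] are trees rooted at [s], so [x] has only one parent. *)
Lemma girth_parent_unique E H s x y y' : symmetric_edges E -> girth_gt (2 * H - 1) E ->
  (y, x) \in E -> (y', x) \in E -> graph_dist E H s x < H ->
  graph_dist E H s y <= graph_dist E H s x -> graph_dist E H s y' <= graph_dist E H s x ->
  y = y'.
Proof.
move=> sE gE yx y'x sx sy sy'; apply/eqP; apply: contraT => yy'.
have avoid z : (z, x) \in E -> graph_dist E H s z <= graph_dist E H s x ->
    reach (E :\: edge x y) H.-1 s z.
  move=> zx sz; apply: (@reach_leq _ (graph_dist E H s z)); first lia.
  have sub : [set e in E | (e.1 != x) && (e.2 != x)] \subset E :\: edge x y.
    apply/subsetP => -[p q]; rewrite !inE !xpair_eqE /= => /and3P[-> /negPf-> /negPf->].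
    by rewrite andbF.
  apply: (reach_subset sub); apply: reach_avoid.
  - move=> i iz; apply/negP => six; have : graph_dist E H s x <= i.
      by rewrite graph_dist_leq six orbT.
    lia.
  - exact: girth_irrefl gE zx.
  - by apply: graph_dist_reach; lia.
have xy : (x, y) \in E by rewrite (symmetric_edgesP sE).
have xny := girth_irrefl gE yx.
move/girth_gtP: gE => /(_ _ _ xy)/negP[].
have sD : symmetric_edges (E :\: edge x y) by apply: symmetric_setD.
(* The edge from [x] to [y'], then the walks to [s] and on to [y], form a detour around the edge
   [(x, y)] of length at most [2 * H - 1]. *)
apply: (@reach_leq _ (1 + H.-1 + H.-1)); first lia.
apply: reach_trans (avoid _ yx sy); apply: reach_trans (reach_sym sD (avoid _ y'x sy')).
apply: reach_edge; rewrite !inE (symmetric_edgesP sE) y'x andbT.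
rewrite !xpair_eqE /= eqxx /= [y' == y]eq_sym (negPf yy') /=.
by rewrite [x == y]eq_sym (negPf xny).
Qed.

(** * Maximal graphs of large girth and bounded degree *)

Definition nbrs E x : {set T} := [set y | (x, y) \in E].

Lemma card_ball E k j x : (forall y, #|nbrs E y| <= k) ->
  #|[set y | reach E j x y]| <= k.+1 ^ j.
Proof.
move=> hk; elim: j => [|j IH].
  by rewrite expn0 (eq_card1 (x := x)) // => y; rewrite !inE eq_sym.
have sub : [set y | reach E j.+1 x y] \subset
    [set y | reach E j x y] :|: \bigcup_(z in [set y | reach E j x y]) nbrs E z.
  apply/subsetP => y; rewrite !inE /= => /orP[->//|/existsP[z /andP[xz zy]]].
  by apply/orP; right; apply/bigcupP; exists z; rewrite inE.
apply: leq_trans (subset_leq_card sub) _; apply: leq_trans (leq_card_setU _ _) _.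
apply: (@leq_trans (#|[set y | reach E j x y]| + #|[set y | reach E j x y]| * k)).
  rewrite leq_add2l -sum_nat_const.
  apply: leq_trans (_ : _ <= \sum_(z in [set y | reach E j x y]) #|nbrs E z|) _.
    elim/big_rec2: _ => [|z A B _ AB]; first by rewrite cards0.
    by apply: leq_trans (leq_card_setU _ _) _; rewrite leq_add2l.
  exact: leq_sum.
by rewrite -mulnS mulnC expnS leq_mul2l IH orbT.
Qed.

Lemma high_girth_graph g k : 0 < g -> exists E,
  [/\ symmetric_edges E, girth_gt g E, forall x, #|nbrs E x| <= k
    & #|[set x | #|nbrs E x| < k]| <= k.+1 ^ g].
Proof.
move=> g0.
pose P E := [&& symmetric_edges E, girth_gt g E & [forall x, #|nbrs E x| <= k]].
have [E /maxsetP[/and3P[sE gE /forallP dE] maxE]] : {E | maxset P E}.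
  apply: ex_maxset; exists set0; apply/and3P; split.
  - by apply/forallP => x; apply/forallP => y; rewrite !inE.
  - by apply/girth_gtP => a b; rewrite inE.
  - apply/forallP => x; rewrite /nbrs (_ : [set y | _] = set0) ?cards0 //.
    by apply/setP => y; rewrite !inE.
exists E; split=> //.
have [->|[u]] := set_0Vmem [set x | #|nbrs E x| < k]; first by rewrite cards0.
rewrite inE => uk; apply: leq_trans (_ : _ <= #|[set y | reach E g u y]|) _; last exact: card_ball.
(* If [v] were out of reach of [u], adding the edge between them would preserve [P], against
   maximality. *)
apply: subset_leq_card; apply/subsetP => v; rewrite !inE => vk; apply: contraT => nuv.
have uv : u != v by apply: contra nuv => /eqP->; exact: reach_refl.
have degS w w' : #|nbrs E w| < k -> #|nbrs E w :|: [set w']| <= k.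
  by move=> wk; rewrite setUC cardsU1; case: (_ \notin _) => //; exact: ltnW.
have PE' : P (E :|: edge u v).
  apply/and3P; split; [exact: symmetric_setU|exact: girth_add_edge|].
  apply/forallP => x; have [->|xu] := eqVneq x u.
    apply: leq_trans (degS _ v uk); apply: subset_leq_card; apply/subsetP => y.
    rewrite !inE !xpair_eqE /= eqxx (negPf uv) /= orbF; exact.
  have [->|xv] := eqVneq x v.
    apply: leq_trans (degS _ u vk); apply: subset_leq_card; apply/subsetP => y.
    rewrite !inE !xpair_eqE /= eqxx [v == u]eq_sym (negPf uv) /=; exact.
  apply: leq_trans (dE x); apply: subset_leq_card; apply/subsetP => y.
  by rewrite !inE !xpair_eqE /= (negPf xu) (negPf xv) /= orbF.
have E'E := maxE _ PE' (subsetUl _ _).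
have : (u, v) \in E by rewrite -E'E !inE eqxx orbT.
by move=> /reach_edge h; case/negP: nuv; exact: reach_leq h.
Qed.

End Reach.

(** * Counting the datasets on which a fixed map is cheap *)

Section Counting.
Set Implicit Arguments. Unset Strict Implicit. Unset Printing Implicit Defensive.
Import fintype mathcomp.boot.finset.
Local Open Scope nat_scope.
Variables (T : finType) (E : {set T * T}) (M J : nat).
Hypotheses (sE : symmetric_edges E) (gE : girth_gt (2 * M.+2 - 1) E).

Let dist := graph_dist E M.+2.

(** If [c] has [J * M] neighbours, the [J] chunks partition them into blocks of size [M], and the
    default value of [nth] never occurs. *)
Definition chunk (c : T) (j : 'I_J) (i : 'I_M) : T := nth c (enum (nbrs E c)) (j * M + i).

Variable C : {set T}.
Hypothesis degC : forall c, c \in C -> #|nbrs E c| = J * M.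

Lemma chunk_index_lt (j : 'I_J) (i : 'I_M) : j * M + i < J * M.
Proof.
have := ltn_ord j; have := ltn_ord i => hi hj.
apply: (@leq_trans (j.+1 * M)); first by rewrite mulSn addnC ltn_add2r.
by rewrite leq_mul2r hj orbT.
Qed.

Lemma chunk_edge c j i : c \in C -> (chunk c j i, c) \in E.
Proof.
move=> cC; rewrite (symmetric_edgesP sE).
have : chunk c j i \in enum (nbrs E c).
  by rewrite mem_nth // -cardE (degC cC) chunk_index_lt.
by rewrite mem_enum inE.
Qed.

Lemma chunk_inj c j j' i i' : c \in C -> chunk c j i = chunk c j' i' -> j = j' /\ i = i'.
Proof.
move=> cC /eqP; rewrite nth_uniq ?enum_uniq // -?cardE ?(degC cC) ?chunk_index_lt //.
move=> /eqP e; have iM := ltn_ord i; have i'M := ltn_ord i'.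
have M0 : 0 < M by exact: leq_ltn_trans iM.
have := congr1 (divn^~ M) e; have := congr1 (modn^~ M) e.
rewrite !modnMDl !divnMDl // !modn_small // !divn_small // !addn0 => h1 h2.
by split; exact: val_inj.
Qed.

Implicit Types psi : T -> T.

(* The shortest path from [x] to its facility, which must be nearby, starts with the edge to [c]. *)
Definition hit psi c x := (dist x (psi x) <= M) && (dist (psi x) c < dist (psi x) x).

(** The two quarters leave half of the [M] clients to be hit, while exceeding either one already
    costs more than [M^2/4]. *)
Definition few_far psi c j :=
  (4 * #|[set psi (chunk c j i) | i : 'I_M]| <= M) &&
  (4 * #|[set i : 'I_M | M < dist (chunk c j i) (psi (chunk c j i))]| <= M).

(* Two clients around [c] that are not hit cannot share a nearby facility [s]:
   both would be parents of [c] in the tree rooted at [s]. *)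
Lemma many_hits psi c j : c \in C -> few_far psi c j ->
  M <= 2 * #|[set i | hit psi c (chunk c j i)]|.
Proof.
move=> cC /andP[few far].
set S := [set psi _ | i in _] in few; set F := [set i | _] in far.
set h := [set i | _]; set N := ~: (h :|: F).
have NS : #|N| <= #|S|.
  have inj : {in N &, injective (fun i => psi (chunk c j i))}.
    have low i : i \in N -> dist (psi (chunk c j i)) (chunk c j i) <= M /\
        dist (psi (chunk c j i)) (chunk c j i) <= dist (psi (chunk c j i)) c.
      rewrite !inE negb_or -leqNgt => /andP[nh near]; split.
        by rewrite /dist graph_dist_sym.
      by move: nh; rewrite /hit near /= -leqNgt.
    move=> i i' /low[n1 l1] /low[n2 l2] e.
    apply: (proj2 (@chunk_inj c j j i i' cC _)).
    have eC k := chunk_edge j k cC.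
    apply: (girth_parent_unique (s := psi (chunk c j i)) sE gE (eC i) (eC i')) => //.
    (* Here [c] is one edge away from a client within [M] of the facility, so it lies at distance at
       most [M + 1], just below the truncation [M.+2]. *)
    - have := graph_dist_triangle E M.+2 (psi (chunk c j i)) (chunk c j i) c.
      have := graph_dist_edge M.+2 (eC i).
      by rewrite /dist in n1 *; lia.
    - by rewrite e.
  rewrite -(card_in_imset inj); apply: subset_leq_card.
  by apply/subsetP => _ /imsetP[i _ ->]; apply: imset_f.
have : #|h :|: F| <= #|h| + #|F| by exact: leq_card_setU.
have := cardsC (h :|: F); rewrite card_ord -/N; lia.
Qed.

(** Double counting of hits. Each good pair contributes at least [M / 2] of them. A vertex is hit
    from only one centre, its parent in the tree rooted at its facility, and the centre then
    determines [j] and [i]; so there are at most [#|T|] hits. *)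
Lemma card_few_far psi :
  M * #|[set cj : T * 'I_J | (cj.1 \in C) && few_far psi cj.1 cj.2]| <= 2 * #|T|.
Proof.
set G := [set cj | _].
pose B := [set t : (T * 'I_J) * 'I_M | (t.1 \in G) && hit psi t.1.1 (chunk t.1.1 t.1.2 t.2)].
have inj : {in B &, injective (fun t => chunk t.1.1 t.1.2 t.2)}.
  move=> [[c j] i] [[c' j'] i']; rewrite !inE /=.
  move=> /andP[/andP[cC _] hc] /andP[/andP[c'C _] hc'] e.
  have cc' : c = c'.
    rewrite -e in hc'; move/andP: hc => [near hc]; move/andP: hc' => [_ hc'].
    apply: (girth_parent_unique (s := psi (chunk c j i)) (x := chunk c j i) sE gE).
    - by rewrite (symmetric_edgesP sE) chunk_edge.
    - by rewrite (symmetric_edgesP sE) e chunk_edge.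
    - by rewrite graph_dist_sym // ltnW.
    - exact: ltnW.
    - exact: ltnW.
  by rewrite -cc' in e *; have [-> ->] := chunk_inj cC e.
rewrite mulnC -sum_nat_const.
apply: (@leq_trans (\sum_(cj in G) 2 * #|[set i | hit psi cj.1 (chunk cj.1 cj.2 i)]|)).
  by apply: leq_sum => cj; rewrite inE => /andP[cC ff]; exact: many_hits.
rewrite -big_distrr /= leq_mul2l /=.
apply: leq_trans (_ : #|B| <= _); last first.
  by rewrite -(card_in_imset inj) max_card.
rewrite -sum1_card.
under eq_bigr do rewrite -sum1_card.
rewrite pair_big_dep /=; apply: eq_leq; apply: eq_bigl => -[cj i].
by rewrite !inE.
Qed.
End Counting.

(** * Group privacy, bounds on the optimum, and Markov's inequality *)

Section Privacy.
Set Implicit Arguments. Unset Strict Implicit. Unset Printing Implicit Defensive.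
Import fintype mathcomp.boot.finset.
Variables (R : realType) (V : finType).
Implicit Types (d : V -> V -> R) (f : V -> R) (A : algorithm R V) (psi : {ffun V -> V}).

Lemma group_privacy (eps : R) A f m (X Y : m.-tuple V) psi : is_DP eps A ->
  A f m X psi <= expR eps ^+ m * A f m Y psi.
Proof.
move=> dp.
(* Hybrids from [X] to [Y]: consecutive ones differ in at most coordinate [t], so each step costs
   one factor [expR eps]. *)
pose Z t : m.-tuple V := mktuple (fun i : 'I_m => if (i < t)%N then tnth Y i else tnth X i).
have hybrid t : A f m (Z 0%N) psi <= expR eps ^+ t * A f m (Z t) psi.
  elim: t => [|t IH]; first by rewrite expr0 mul1r.
  apply: le_trans IH _; rewrite exprSr -mulrA ler_wpM2l ?exprn_ge0 ?expR_ge0 //.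
  apply: dp; rewrite /Defs.adjacent.
  apply: (@leq_trans #|[pred i : 'I_m | val i == t]|).
    apply: subset_leq_card; apply/subsetP => i; rewrite !inE !tnth_mktuple ltnS.
    by case: ltngtP; rewrite ?eqxx.
  apply/card_le1_eqP => i j; rewrite !inE => /eqP it /eqP jt.
  by apply: val_inj; rewrite /= it jt.
have -> : X = Z 0%N by apply: eq_from_tnth => i; rewrite tnth_mktuple.
have -> : Y = Z m by apply: eq_from_tnth => i; rewrite tnth_mktuple ltn_ord.
exact: hybrid.
Qed.

Lemma dist_set1 d c x : dist_set d [set c] x = d x c.
Proof.
rewrite /dist_set /Order.arg_min /extremum /=; case: pickP => [u|/(_ c)] /=.
  by rewrite inE => /andP[/eqP->].
by rewrite inE eqxx /= => /forallP[]; move=> u; rewrite inE; apply/implyP => /eqP->.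
Qed.

Lemma opt_le_cost1 d f m (X : m.-tuple V) c :
  opt d f X <= f c + \sum_(i < m) d (tnth X i) c.
Proof.
rewrite /opt; case: Order.TotalTheory.arg_minP => [|S _ /(_ [set c])].
  by apply/card_gt0P; exists c; rewrite inE.
rewrite cards1 => /(_ isT) /le_trans; apply.
rewrite /cost_set big_set1 lerD2l; apply: ler_sum => i _.
by rewrite dist_set1.
Qed.

Lemma opt_ge0 d f m (X : m.-tuple V) : (forall x y, 0 <= d x y) -> nonneg_costs f ->
  0 <= opt d f X.
Proof. by move=> d0 f0; rewrite addr_ge0 // sumr_ge0 // => i _; exact: d0. Qed.

Lemma markov_half (P : {ffun {ffun V -> V} -> R}) (cost : {ffun V -> V} -> R)
    (good : pred {ffun V -> V}) (B : R) : is_distribution P ->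
  (forall psi, 0 <= cost psi) -> 0 < B -> \sum_psi P psi * cost psi <= B ->
  (forall psi, ~~ good psi -> 2 * B <= cost psi) ->
  1 / 2 <= \sum_(psi | good psi) P psi.
Proof.
move=> [P0 P1] c0 B0 hB hgood.
have bad : 2 * B * \sum_(psi | ~~ good psi) P psi <= B.
  apply: le_trans hB; rewrite [leRHS](bigID good) /= mulr_sumr ler_wpDl //.
    by apply: sumr_ge0 => psi _; rewrite mulr_ge0.
  by apply: ler_sum => psi /hgood h; rewrite mulrC ler_wpM2l.
rewrite (bigID good) /= in P1; nra.
Qed.

End Privacy.

(** * From an approximation ratio to a contradiction with privacy *)

Section LowerBound.
Set Implicit Arguments. Unset Strict Implicit. Unset Printing Implicit Defensive.
Import fintype mathcomp.boot.finset.
Variables (R : realType) (V : finType) (E : {set V * V}) (M J : nat).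
Hypotheses (M0 : (0 < M)%N) (sE : symmetric_edges E) (gE : girth_gt (2 * M.+2 - 1) E).

Definition graph_metric (x y : V) : R := (graph_dist E M.+2 x y)%:R.

Lemma is_metric_graph_metric : is_metric graph_metric.
Proof.
split; [|split; [|split]] => [x y|x y|x y|x y z].
- exact: ler0n.
- split=> [/eqP|->]; last by apply/eqP; rewrite pnatr_eq0 graph_dist_eq0.
  by rewrite pnatr_eq0 graph_dist_eq0 // => /eqP.
- by rewrite /graph_metric graph_dist_sym.
- by rewrite /graph_metric -natrD ler_nat graph_dist_triangle.
Qed.

Let f (_ : V) : R := M%:R.

(** Either more than [M / 4] facilities of cost [M] are open, or more than [M / 4] clients travel
    further than [M]. The bound is written as [2 * B] with [B = M^2/8] to fit [markov_half]. *)
Lemma cost_ge_of_not_few_far (psi : {ffun V -> V}) c (j : 'I_J) :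
  ~~ few_far E M psi c j ->
  2 * ((M * M)%:R / 8) <= cost_map graph_metric f (mktuple (@chunk V E M J c j)) psi.
Proof.
set S := [set psi (chunk E c j i) | i : 'I_M].
set F := [set i : 'I_M | M < graph_dist E M.+2 (chunk E c j i) (psi (chunk E c j i))]%N.
rewrite /few_far -/S -/F => bad.
have -> : cost_map graph_metric f (mktuple (@chunk V E M J c j)) psi =
    (M * #|S| + \sum_(i < M) graph_dist E M.+2 (chunk E c j i) (psi (chunk E c j i)))%:R.
  rewrite /cost_map natrD natr_sum; congr (_ + _).
    rewrite /f sumr_const -[LHS]mulr_natr natrM; congr (_ * _%:R); apply: eq_card => v.
    by congr (v \in pred_of_set _); apply: eq_imset => i; rewrite tnth_mktuple.
  by apply: eq_bigr => i _; rewrite /graph_metric tnth_mktuple.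
have sumF : (#|F| * M <= \sum_(i < M) graph_dist E M.+2 (chunk E c j i) (psi (chunk E c j i)))%N.
  rewrite [leqRHS](bigID (mem F)) /= -sum_nat_const; apply: leq_trans (leq_addr _ _).
  by apply: leq_sum => i; rewrite inE; exact: ltnW.
set s := (\sum_(i < M) _)%N in sumF *.
suff : (M * M <= 4 * (M * #|S| + s))%N.
  by rewrite -(ler_nat R) natrM [(4 * _)%:R]natrM; lra.
by move: bad; rewrite negb_and -!ltnNge => /orP[]; nia.
Qed.

Variables (C : {set V}) (eps alpha : R) (A : algorithm R V).
Hypotheses (degC : forall c, c \in C -> #|nbrs E c| = (J * M)%N)
  (valA : valid_algorithm A) (dpA : is_DP eps A) (ratioA : has_approx_ratio graph_metric A alpha).

Lemma few_far_probability c (j : 'I_J) : c \in C -> alpha < M%:R / 16 ->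
  1 / 2 <= \sum_(psi : {ffun V -> V} | few_far E M psi c j) A f (mktuple (@chunk V E M J c j)) psi.
Proof.
move=> cC al; set X := mktuple _.
have f0 : nonneg_costs f by move=> v; exact: ler0n.
have d0 x y : 0 <= graph_metric x y by exact: ler0n.
have M0' : 0 < M%:R :> R by rewrite ltr0n.
apply: (@markov_half _ _ _ (cost_map graph_metric f X) _ ((M * M)%:R / 8)) => //.
- by move=> psi; rewrite addr_ge0 // sumr_ge0.
- by rewrite divr_gt0 // ltr0n muln_gt0 M0.
- have := ratioA f0 X; rewrite /expected_cost => /le_trans; apply.
  (* Opening [c] alone suffices; then [alpha < M / 16] makes the expected cost at most [M^2/8]. *)
  have : opt graph_metric f X <= 2 * M%:R.
    apply: le_trans (opt_le_cost1 _ _ _ c) _; rewrite mulr2n mulrDl mul1r lerD2l.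
    rewrite -[leRHS]mulr1 mulr_natl -[in leRHS](card_ord M) -sumr_const.
    apply: ler_sum => i _; rewrite tnth_mktuple /graph_metric -[1]/(1%:R) ler_nat.
    by apply: graph_dist_edge; exact: (chunk_edge sE degC).
  have := opt_ge0 X d0 f0; rewrite natrM; nra.
- by move=> psi; exact: cost_ge_of_not_few_far.
Qed.

(** Compare every dataset with one reference dataset, whose output law is [Q]. The expected number
    of good pairs under [Q] is at least [#|C| * J / (2 * expR eps ^+ M)] and at most
    [2 * #|V| / M <= 4 * #|C| / M], so [J * M <= 8 * expR eps ^+ M]. *)
Lemma ratio_ge : (0 < #|C|)%N -> (#|V| <= 2 * #|C|)%N ->
  8 * expR eps ^+ M < (J * M)%:R -> M%:R / 16 <= alpha.
Proof.
move=> C0 CV big; rewrite leNgt; apply/negP => al.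
have [v0 _] := card_gt0P C0.
set Q := A f (nseq_tuple M v0).
have e0 : 0 < expR eps ^+ M by rewrite exprn_gt0 ?expR_gt0.
have low c (j : 'I_J) : c \in C ->
    1 / 2 <= expR eps ^+ M * \sum_(psi : {ffun V -> V} | few_far E M psi c j) Q psi.
  move=> cC; apply: le_trans (few_far_probability j cC al) _; rewrite mulr_sumr.
  by apply: ler_sum => psi _; exact: group_privacy.
pose G (psi : {ffun V -> V}) := [set cj : V * 'I_J | (cj.1 \in C) && few_far E M psi cj.1 cj.2].
have [Q0 Q1] := valA f (nseq_tuple M v0).
have total : (#|C| * J)%:R * (1 / 2) <= expR eps ^+ M * \sum_psi Q psi * #|G psi|%:R.
  have -> : \sum_psi Q psi * #|G psi|%:R =
      \sum_(cj : V * 'I_J | cj.1 \in C)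
        \sum_(psi : {ffun V -> V} | few_far E M psi cj.1 cj.2) Q psi.
    (* By linearity, the good-event probabilities summed over all pairs give the expected size of
       [G]. *)
    rewrite (exchange_big_dep predT) //=; apply: eq_bigr => psi _.
    by rewrite sumr_const mulr_natr; congr (_ *+ _); apply: eq_card => cj; rewrite !inE.
  rewrite mulr_sumr; apply: (@le_trans _ _ (\sum_(cj : V * 'I_J | cj.1 \in C) (1 / 2 : R))).
    rewrite sumr_const -[leRHS]mulr_natl ler_wpM2r ?divr_ge0 // ler_nat; apply: eq_leq.
    rewrite -[J in LHS]card_ord -cardsT -cardsX; apply: eq_card => -[c j].
    by rewrite !inE andbT.
  by apply: ler_sum => -[c j] /= cC; exact: low.
have upper : M%:R * \sum_psi Q psi * #|G psi|%:R <= (2 * #|V|)%:R.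
  have -> : (2 * #|V|)%:R = \sum_psi Q psi * (2 * #|V|)%:R by rewrite -mulr_suml Q1 mul1r.
  rewrite mulr_sumr; apply: ler_sum => psi _.
  rewrite mulrCA ler_wpM2l // -natrM ler_nat; exact: (card_few_far sE gE degC psi).
have C0' : 0 < #|C|%:R :> R by rewrite ltr0n.
have M0' : 0 < M%:R :> R by rewrite ltr0n.
have CV' : (2 * #|V|)%:R <= 4 * #|C|%:R :> R by rewrite -natrM ler_nat; lia.
rewrite !natrM in total big.
set S := \sum_psi _ in total upper.
have h1 : M%:R * (#|C|%:R * J%:R * (1 / 2)) <= expR eps ^+ M * (4 * #|C|%:R).
  apply: le_trans (_ : M%:R * (expR eps ^+ M * S) <= _); first by rewrite ler_wpM2l // ltW.
  rewrite mulrCA ler_wpM2l ?(ltW e0) //; exact: le_trans CV'.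
have : #|C|%:R * (8 * expR eps ^+ M) < #|C|%:R * (J%:R * M%:R) by rewrite ltr_pM2l.
lra.
Qed.
End LowerBound.

(** * Choice of the graph and of the parameters *)

Lemma exists_metric_ratio_ge (R : realType) (n M J : nat) (eps : R) : (0 < M)%N ->
  (2 * (J * M).+1 ^ (2 * M + 3) <= n)%N -> 8 * expR eps ^+ M < (J * M)%:R ->
  exists d : 'I_n -> 'I_n -> R, is_metric d /\
    forall (A : algorithm R 'I_n) (alpha : R),
      valid_algorithm A -> is_DP eps A -> has_approx_ratio d A alpha -> M%:R / 16 <= alpha.
Proof.
move=> M0 nbig big.
have g0 : (0 < 2 * M.+2 - 1)%N by lia.
have [E [sE gE degE defE]] := @high_girth_graph 'I_n _ (J * M)%N g0.
exists (@graph_metric R _ E M); split; first exact: is_metric_graph_metric.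
move=> A alpha valA dpA ratioA.
pose C := [set x | #|nbrs E x| == J * M]%N.
(* The lower bound on [n] makes the vertices of deficient degree at most half of all. *)
have CV : (#|'I_n| <= 2 * #|C|)%N.
  have : (#|~: C| <= (J * M).+1 ^ (2 * M + 3))%N.
    have -> : (2 * M + 3 = 2 * M.+2 - 1)%N by lia.
    apply: leq_trans defE; apply: subset_leq_card; apply/fintype.subsetP => x.
    by rewrite !finset.inE => h; rewrite ltn_neqAle h degE.
  have := finset.cardsC C; rewrite card_ord; lia.
have n0 : (0 < n)%N by apply: leq_trans nbig; rewrite muln_gt0 expn_gt0.
apply: (ratio_ge (C := C) M0 sE gE _ valA dpA ratioA _ CV big).
  by move=> c; rewrite finset.inE => /eqP.
by rewrite card_ord in CV; lia.
Qed.

(** In logarithms, with [5 * M] replacing [2 * M + 3], the size is at most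
    [1 + 5 * M * (4 + l + eps * M)]. The assumptions bound [5 * M * l] by [L / 4] and
    [5 * eps * M^2] by [L / 80], and [l >= 80] makes the rest small. *)
Lemma graph_size_bound (R : realType) (eps : R) (n M J : nat) :
  let L := ln (n%:R : R) in let l := ln L in
  0 < eps -> (0 < n)%N -> 0 < L -> 80 <= l -> (0 < M)%N ->
  20 * M%:R * l <= L -> 400 * (eps * M%:R * M%:R) <= L ->
  J%:R <= 8 * expR eps ^+ M + 1 ->
  (2 * (J * M).+1 ^ (2 * M + 3) <= n)%N.
Proof.
move=> L l e0 n0 L0 l80 M0 Ml Me Jb.
have exponent : (2 * M + 3 <= 5 * M)%N by clear -M0; lia.
have M1 : 1 <= M%:R :> R by rewrite ler1n.
have e1 : 1 <= expR (eps * M%:R) by rewrite -expR0 ler_expR mulr_ge0 // ltW.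
rewrite -expRM_natr in Jb.
have two : 2 <= expR 1 :> R by have := @expR_ge1Dx R 1; lra.
have ML : M%:R <= expR l by rewrite lnK ?posrE //; nra.
have sixteen : 10 <= expR 4 :> R.
  have -> : expR 4 = (expR 1 ^+ 2) ^+ 2 :> R by rewrite -exprM -expRM_natr mul1r.
  have : 4 <= expR 1 ^+ 2 :> R.
    by move: (expR 1) two => y y2; rewrite expr2; clear -y2; nra.
  by move: (expR 1 ^+ 2) => y y4; rewrite expr2; clear -y4; nra.
(* Since [M] and [expR (eps * M)] are at least 1, the factor 10 absorbs both additive ones; it is
   then bounded by [expR 4], and [M] by [expR l]. *)
have base : (J * M).+1%:R <= expR (4 + l + eps * M%:R).
  rewrite expRD [expR (4 + l)]expRD -natr1 natrM.
  apply: (@le_trans _ _ (10 * M%:R * expR (eps * M%:R))); first by nra.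
  rewrite ler_wpM2r ?expR_ge0 //; exact: ler_pM.
rewrite -(ler_nat R) natrM natrX.
have b1 : 1 <= (J * M).+1%:R :> R by rewrite ler1n.
have -> : n%:R = expR L by rewrite lnK // posrE ltr0n.
apply: (@le_trans _ _ (expR 1 * expR (4 + l + eps * M%:R) ^+ (5 * M))).
  apply: ler_pM => //.
  apply: (@le_trans _ _ ((J * M).+1%:R ^+ (5 * M))).
    exact: ler_weXn2l.
  by rewrite lerXn2r // nnegrE ?expR_ge0.
rewrite -expRM_natr -expRD ler_expR natrM.
have LM : 80 * M%:R <= l * M%:R by rewrite ler_wpM2r.
lra.
Qed.

Theorem theorem1 (R : realType) (eps0 : R) :
  0 < eps0 ->
  exists c : R, 0 < c /\
  exists N : nat,
    forall eps : R, 0 < eps -> eps <= eps0 ->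
    forall n : nat, (N <= n)%N ->
    exists d : 'I_n -> 'I_n -> R,
      is_metric d /\
      forall (A : algorithm R 'I_n) (alpha : R),
        valid_algorithm A -> is_DP eps A -> has_approx_ratio d A alpha ->
        c * Num.min (ln (n%:R : R) / ln (ln (n%:R : R)))
                    (Num.sqrt (ln (n%:R : R) / eps)) <= alpha.
Proof.
(* With [m] the minimum and [M] the integer part of [m / 20], [m >= 20] gives [M >= m / 40]; the
   ratio [M / 16] yields 1/640. *)
move=> eps00; exists (1 / 640); split; first lra.
(* The term [expR 80] ensures [l >= 80]; the term [400 * eps0] ensures [L / eps >= 400], so that the
   square root is at least 20. *)
exists (Num.truncn (expR (expR 80 + 400 * eps0))).+1 => eps e0 ee0 n Nn.
have nbig : expR (expR 80 + 400 * eps0) <= n%:R.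
  by apply: le_trans (ltW (truncnS_gt _)) _; rewrite ler_nat.
have n0 : (0 < n)%N by apply: leq_trans Nn.
have nR0 : 0 < n%:R :> R by rewrite ltr0n.
set L := ln (n%:R : R).
have LE : expR L = n%:R by rewrite lnK.
have Lbig : expR 80 + 400 * eps0 <= L by rewrite -ler_expR LE.
have L0 : 0 < L by have := @expR_gt0 R 80; lra.
set l := ln L.
have lE : expR l = L by rewrite lnK.
have l80 : 80 <= l by rewrite -ler_expR lE; lra.
have l20 : 20 * l <= L.
  have := @expR_ge1Dx R (l / 2) => h.
  have : (1 + l / 2) ^+ 2 <= L.
    rewrite -lE (_ : l = l / 2 + l / 2); last lra.
    rewrite expRD -expr2 -splitr lerXn2r // nnegrE ?expR_ge0 //; lra.
  rewrite expr2; nra.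
have l0 : 0 < l by lra.
set m := Num.min _ _.
have m1 : m <= L / l by rewrite ge_min lexx.
have m2 : m <= Num.sqrt (L / eps) by rewrite ge_min lexx orbT.
have m20 : 20 <= m.
  rewrite le_min ler_pdivlMr // l20 /= -[20]ger0_norm // -sqrtr_sqr.
  rewrite ler_wsqrtr // ler_pdivlMr // expr2; have := @expR_gt0 R 80; nra.
have m0 : 0 <= m by lra.
clearbody m.
pose M := Num.truncn (m / 20).
have /andP[Mle Mgt] : M%:R <= m / 20 < M.+1%:R by apply: truncn_itv; lra.
rewrite -[M.+1%:R]natr1 in Mgt.
have M0 : (0 < M)%N by rewrite truncn_gt0; lra.
have M1 : 1 <= M%:R :> R by rewrite ler1n.
have E0 : 0 <= expR eps ^+ M by rewrite exprn_ge0 ?expR_ge0.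
(* The witness is [J = K.+1], just above [8 * expR eps ^+ M]: large enough for the contradiction,
   and small enough for the size bound. *)
have [K /andP[Kle Kgt]] : exists K : nat, K%:R <= 8 * expR eps ^+ M < K.+1%:R.
  by exists (Num.truncn (8 * expR eps ^+ M)); apply: truncn_itv; rewrite mulr_ge0.
have big : 8 * expR eps ^+ M < (K.+1 * M)%:R.
  by apply: lt_le_trans Kgt _; rewrite ler_nat leq_pmulr.
have [|d [md hd]] := @exists_metric_ratio_ge R n M K.+1 eps M0 _ big.
  apply: (@graph_size_bound R eps) => //; rewrite -/L -/l.
  - apply: (@le_trans _ _ (m * l)); last by rewrite -ler_pdivlMr.
    by rewrite ler_wpM2r ?(ltW l0) // mulrC -ler_pdivlMr.
  - have : m ^+ 2 <= L / eps.
      have Le0 : 0 <= L / eps by rewrite divr_ge0 // ltW.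
      rewrite -[leRHS]sqr_sqrtr // lerXn2r ?nnegrE ?sqrtr_ge0 //.
    rewrite ler_pdivlMr //; apply: le_trans.
    have -> : 400 * (eps * M%:R * M%:R) = (20 * M%:R) ^+ 2 * eps by clear; ring.
    rewrite ler_wpM2r ?(ltW e0) // lerXn2r ?nnegrE ?mulr_ge0 //.
    by rewrite mulrC -ler_pdivlMr.
  - by rewrite -natr1 lerD2r.
exists d; split=> // A alpha vA dA rA.
have := hd A alpha vA dA rA; lra.
Qed.
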